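(* Let $k$ be a subfield of $\mathbf{C}$ and let $A$ be a locally finite graded set with an operation $[\cdot,\cdot]$ on $\bar A=A\cup\{0\}$ satisfying (S0)–(S3). Any $q\in k$ that is not a root of unity is generic; that is, if $q\in k$ is not a root of unity, then the algebra homomorphism $\Phi_q:(\mathfrak{A},\mathrm{conc})\to(\mathfrak{A},*_q)$ is an isomorphism.
   Context: $A$ is a graded set, $A=\bigsqcup_{n\ge1}A_n$ with each $A_n$ (the elements of degree $n$) finite; elements of $A$ are called letters and $|a|$ is the degree of a letter $a$. $\mathfrak{A}=k\langle A\rangle$ is the $k$-vector space of noncommutative polynomials in the letters, with basis the words (monomials) in the letters, including the empty word $1$; juxtaposition (also written $\mathrm{conc}$) denotes the concatenation product. The degree $|w|$ of a word $w$ is the sum of the degrees of its letters. Let $\bar A=A\cup\{0\}$ and let $[\cdot,\cdot]:\bar A\times\bar A\to\bar A$ be a function satisfying: (S0) $[a,0]=0$ for all $a\in\bar A$; (S1) $[a,b]=[b,a]$ for all $a,b\in\bar A$; (S2) $[[a,b],c]=[a,[b,c]]$ for all $a,b,c\in\bar A$; (S3) for all $a,b\in A$, either $[a,b]=0$ or $|[a,b]|=|a|+|b|$. For $q\in k$, the product $*_q$ is the $k$-bilinear (associative) operation on $\mathfrak{A}$ defined recursively on words by $1*_qw=w*_q1=w$ and $aw_1*_qbw_2=a(w_1*_qbw_2)+q^{|aw_1||b|}\,b(aw_1*_qw_2)+q^{|w_1||b|}\,[a,b](w_1*_qw_2)$ for letters $a,b$ and words $w_1,w_2$ (with $q^0=1$,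 also for $q=0$). $\Phi_q:(\mathfrak{A},\mathrm{conc})\to(\mathfrak{A},*_q)$ is the homomorphism of graded associative $k$-algebras with $\Phi_q(a_1a_2\cdots a_n)=a_1*_qa_2*_q\cdots*_qa_n$ for letters $a_1,\dots,a_n$. The element $q$ is called generic if $\Phi_q$ is an isomorphism (equivalently, surjective). *)

(* Defs.v *)
From HB Require Import structures.
From mathcomp Require Export all_boot all_order all_algebra.
From mathcomp Require Export boolp classical_sets cardinality reals.
From mathcomp.real_closed Require Export complex.
From mathcomp Require Export finmap.
From mathcomp.multinomials Require Export monalg.

Set Implicit Arguments.
Unset Strict Implicit.
Unset Printing Implicit Defensive.

Import GRing.Theory.
Local Open Scope ring_scope.

(* k<A> is the monoid algebra of the free monoid on A; its library ring
   product is concatenation and its unit 1 is the empty word. *)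
Notation ncpoly k A := {malg k[{fmonom A}]}.

Section QuasiShuffle.
Context (k : fieldType) (A : choiceType) (deg : A -> nat).
(* option A is A \cup {0}, with None playing the role of 0. *)
Context (br : option A -> option A -> option A) (q : k).

Definition word (w : seq A) : ncpoly k A := << FMonom w >>.

Definition letter (a : A) : ncpoly k A := word [:: a].

Definition letter0 (x : option A) : ncpoly k A :=
  if x is Some a then letter a else 0.

Definition wdeg (w : seq A) : nat := (\sum_(a <- w) deg a)%N.

Fixpoint qsh_word (u : seq A) : seq A -> ncpoly k A :=
  fix qsh_u (v : seq A) : ncpoly k A :=
    match u, v with
    | [::], _ => word v
    | _, [::] => word u
    | a :: w1, b :: w2 =>
        letter a * qsh_word w1 v
        + q ^+ (wdeg u * deg b) *: (letter b * qsh_u w2)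
        + q ^+ (wdeg w1 * deg b) *:
            (letter0 (br (Some a) (Some b)) * qsh_word w1 w2)
    end.

Definition qsh (f g : ncpoly k A) : ncpoly k A :=
  \sum_(u <- msupp f) \sum_(v <- msupp g) (f@_u * g@_v) *: qsh_word u v.

(* Iterated from the left: ((a_1 *_q a_2) *_q ...) *_q a_n, with the empty
   product equal to 1. *)
Definition Phi_word (w : seq A) : ncpoly k A :=
  foldl (fun f a => qsh f (letter a)) 1 w.

Definition Phi (f : ncpoly k A) : ncpoly k A :=
  \sum_(w <- msupp f) f@_w *: Phi_word w.

(* The product *_q is not registered as a ring structure, so the isomorphism
   of unital algebras (k<A>, conc) -> (k<A>, *_q) is spelled out; both
   algebras have the empty word as unit. *)
Definition generic : Prop :=
  [/\ linear Phi,
      Phi 1 = 1,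
      {morph Phi : f g / f * g >-> qsh f g}
    & bijective Phi].

End QuasiShuffle.

(* Main.v *)
From HB Require Import structures.
Require Import Defs.
From mathcomp Require Import zify.
Import GRing.Theory.
Set Implicit Arguments.
Unset Strict Implicit.
Unset Printing Implicit Defensive.
Local Open Scope ring_scope.
Local Open Scope complex_scope.

(* By associativity Phi(a w) = a * Phi(w), so by induction on length it suffices
   to invert the map L : a v |-> a * v on words of length <= n.  Modulo shorter
   words L is the bracket-free map B, which inserts a into v at every position,
   with weight q^(|a| |p|) when p is the prefix before a.  Let R_d move the first
   letter b of a word b u to the end with weight q^(|b| (|u| + d)).  Then
     (1 - R_0) B = B' (1 - Y),
   where B' applies B to all letters but the last and Y(a v) = a R_{2|a|}(v), so
   B is inverted by induction.  Each 1 - R_d is invertible because R_d^n is a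
   scalar q^N with N > 0 on the rotations of a word of length n, and q^N <> 1. *)

(** A basis is given by its universal property and an induction principle: [lext_bvec] yields
    independence, [basis_ind] spanning. The linear algebra on words uses only this interface. *)
Record basis (k : fieldType) (T : Type) (V : lmodType k) := Basis {
  bvec :> T -> V;
  lext : (T -> V) -> {linear V -> V};
  lext_bvec : forall F t, lext F (bvec t) = F t;
  basis_ind : forall P : V -> Prop,
    P 0 -> (forall c t f, P f -> P (c *: bvec t + f)) -> forall f, P f
}.

(** * Words as a basis of k<A> *)

Section NcpolyBasis.
Context (k : fieldType) (A : choiceType).
Local Notation V := (ncpoly k A).
Implicit Types (f g h : V) (u v w : seq A) (F G : seq A -> V) (c : k).

Definition ncpoly_ext F f : V := \sum_(w <- msupp f) f@_w *: F w.

(** Coefficients outside the support vanish, so sums for different polynomials can be compared over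
    one common finite set. *)
Lemma ncpoly_extEw (d : {fset {fmonom A}}) F f : fsubset (msupp f) d ->
  ncpoly_ext F f = \sum_(w <- d) f@_w *: F w.
Proof.
move=> le_fd; rewrite /ncpoly_ext (big_fset_incl _ le_fd) //= => w _.
by move=> /mcoeff_outdom ->; rewrite scale0r.
Qed.

Lemma ncpoly_ext_is_linear F : linear (ncpoly_ext F).
Proof.
move=> c f g; set d := (msupp f `|` msupp g)%fset.
have df : fsubset (msupp f) d by exact: fsubsetUl.
have dg : fsubset (msupp g) d by exact: fsubsetUr.
have dcfg : fsubset (msupp (c *: f + g)) d.
  apply: (fsubset_trans (msuppD_le _ _)); apply: fsetUSS => //.
  exact: msuppZ_le.
rewrite !(ncpoly_extEw F df, ncpoly_extEw F dg, ncpoly_extEw F dcfg).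
rewrite scaler_sumr -big_split /=.
by apply: eq_bigr => w _; rewrite mcoeffD mcoeffZ scalerDl scalerA.
Qed.

HB.instance Definition _ F :=
  GRing.isLinear.Build k V V *:%R (ncpoly_ext F) (ncpoly_ext_is_linear F).

Lemma ncpoly_ext_word F w : ncpoly_ext F (word k w) = F w.
Proof.
rewrite /ncpoly_ext /word msuppU oner_eq0 big_seq_fset1.
by rewrite mcoeffUU scale1r.
Qed.

Lemma ncpoly_sumE f : f = \sum_(w <- msupp f) f@_w *: word k w.
Proof.
rewrite [LHS]monalgE; apply: eq_bigr => w _; apply/malgP => w'.
by rewrite mcoeffZ !mcoeffU fmK mulr_natr.
Qed.

Lemma ncpoly_ind (P : V -> Prop) :
  P 0 -> (forall c w f, P f -> P (c *: word k w + f)) -> forall f, P f.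
Proof.
move=> P0 PS f; rewrite [f]ncpoly_sumE.
elim: (enum_fset (msupp f)) => [|w s IH]; first by rewrite big_nil.
by rewrite big_cons; apply: PS.
Qed.

Definition ncpoly_basis : basis (seq A) V :=
  Basis ncpoly_ext_word ncpoly_ind.

Lemma word_nil : word k [::] = 1 :> V.
Proof.
rewrite /word /GRing.one /= /fgone; congr (<< _ *g _ >>).
by apply/eqP; rewrite fmP fm1.
Qed.

Lemma mul_ncpolyE f g : f * g =
  lext ncpoly_basis (fun u => lext ncpoly_basis (fun v => word k (u ++ v)) g) f.
Proof.
transitivity (\sum_(u <- msupp f) \sum_(v <- msupp g)
  << f@_u * g@_v *g monalg.mul u v >> : V).
  exact: (@fgmull {fmonom A} k f g).
apply: eq_bigr => u _; rewrite /= /ncpoly_ext scaler_sumr.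
apply: eq_bigr => v _; rewrite scalerA; apply/malgP => w.
rewrite mcoeffZ !mcoeffU mulr_natr; congr (_ *+ (_ == _)).
by apply/eqP; rewrite fmP fmM.
Qed.

Lemma letter_mulE a f :
  letter k a * f = lext ncpoly_basis (fun w => word k (a :: w)) f.
Proof. by rewrite mul_ncpolyE; exact: ncpoly_ext_word. Qed.
End NcpolyBasis.

(** * Linear maps on words and their inverses up to a given length *)

Section WordBasis.
Context (k : fieldType) (A : Type) (V : lmodType k) (word : basis (seq A) V).
Local Notation lext := (lext word).
Implicit Types (f g h : V) (u v w : seq A) (a b : A) (x y z : option A).
Implicit Types (c : k) (F G : seq A -> V) (P Q : seq A -> Prop).

Lemma word_ind (P : V -> Prop) :
  P 0 -> (forall c w f, P f -> P (c *: word w + f)) -> forall f, P f.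
Proof. exact: basis_ind. Qed.

Lemma lext_word F w : lext F (word w) = F w.
Proof. exact: lext_bvec. Qed.

Lemma eq_linear (L M : {linear V -> V}) :
  (forall w, L (word w) = M (word w)) -> L =1 M.
Proof.
move=> eLM; elim/word_ind => [|c w f IH]; first by rewrite !linear0.
by rewrite !linearP eLM IH.
Qed.

(* Left concatenation by [letter0 x]. *)
Definition cons0 x : {linear V -> V} :=
  lext (fun w => if x is Some a then word (a :: w) else 0).

Lemma cons0_word a w : cons0 (Some a) (word w) = word (a :: w).
Proof. exact: lext_word. Qed.

Lemma cons0_None f : cons0 None f = 0.
Proof. by apply: (eq_linear (M := \0)) => w; rewrite lext_word. Qed.


Definition snoc a : {linear V -> V} := lext (fun w => word (rcons w a)).

Lemma snoc_word a w : snoc a (word w) = word (rcons w a).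
Proof. exact: lext_word. Qed.

Lemma snoc_cons0 a x f : snoc a (cons0 x f) = cons0 x (snoc a f).
Proof.
case: x => [b|]; last by rewrite !cons0_None linear0.
apply: (eq_linear (L := snoc a \o cons0 _) (M := cons0 _ \o snoc a)) => w /=.
by rewrite cons0_word !snoc_word cons0_word.
Qed.

Inductive span P : V -> Prop :=
| span0 : span P 0
| span_add c w f : P w -> span P f -> span P (c *: word w + f).

Lemma spanD P f g : span P f -> span P g -> span P (f + g).
Proof.
by elim=> [|c w f' Pw _ IH] Pg; rewrite ?add0r // -addrA; apply/span_add/IH.
Qed.

Lemma spanZ P c f : span P f -> span P (c *: f).
Proof.
elim=> [|d w f' Pw _ IH]; rewrite ?scaler0; first exact: span0.
by rewrite scalerDr scalerA; apply: span_add.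
Qed.

Lemma spanB P f g : span P f -> span P g -> span P (f - g).
Proof. by move=> Pf Pg; rewrite -scaleN1r; apply/spanD/spanZ. Qed.

Lemma span_word P w : P w -> span P (word w).
Proof.
by move=> Pw; rewrite -[word w]addr0 -[word w]scale1r; apply/span_add/span0.
Qed.

Lemma span_linear P Q (L : {linear V -> V}) f :
  (forall w, P w -> span Q (L (word w))) -> span P f -> span Q (L f).
Proof.
move=> PQ; elim=> [|c w f' Pw _ IH]; first by rewrite linear0; apply: span0.
by rewrite linearP; apply: spanD (spanZ _ (PQ _ Pw)) IH.
Qed.

Lemma span_sub P Q f : (forall w, P w -> Q w) -> span P f -> span Q f.
Proof.
by move=> PQ /(span_linear (L := idfun)); apply => w /PQ; apply: span_word.
Qed.

Lemma eq_linear_span P (L M : {linear V -> V}) f :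
  (forall w, P w -> L (word w) = M (word w)) -> span P f -> L f = M f.
Proof.
move=> eLM; elim=> [|c w f' Pw _ IH]; first by rewrite !linear0.
by rewrite !linearP eLM ?IH.
Qed.

Definition upto (n : nat) : V -> Prop := span (fun w => (size w <= n)%N).

Lemma uptoW m n f : (m <= n)%N -> upto m f -> upto n f.
Proof. by move=> le_mn; apply: span_sub => w le_w; apply: leq_trans le_mn. Qed.

Lemma upto_ex f : exists n, upto n f.
Proof.
elim/word_ind: f => [|c w f [n Wf]]; first by exists 0%N; apply: span0.
exists (maxn (size w) n); apply: spanD.
  by apply/spanZ/span_word; rewrite leq_max leqnn.
by apply: uptoW Wf; rewrite leq_max leqnn orbT.
Qed.

Definition filtered F : Prop := forall w, upto (size w) (F w).

Lemma lext_upto n F f : filtered F -> upto n f -> upto n (lext F f).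
Proof.
move=> fF; apply: span_linear => w le_w; rewrite lext_word.
exact: uptoW le_w (fF w).
Qed.

(** Both maps respect length on all words, while the inverse laws are asked only up to length [n],
    which is what an induction on length provides. *)
Definition inverse_upto (n : nat) F G : Prop := [/\ filtered F, filtered G,
  forall f, upto n f -> lext F (lext G f) = f &
  forall f, upto n f -> lext G (lext F f) = f].

Definition invertible_upto n F : Prop := exists G, inverse_upto n F G.

Lemma inverse_uptoI n F G : filtered F -> filtered G ->
  (forall w, (size w <= n)%N -> lext F (G w) = word w) ->
  (forall w, (size w <= n)%N -> lext G (F w) = word w) -> inverse_upto n F G.
Proof.
move=> fF fG FG GF; split=> // f.
  apply: (eq_linear_span (L := lext F \o lext G) (M := idfun)) => w /FG /=.
  by rewrite lext_word.
apply: (eq_linear_span (L := lext G \o lext F) (M := idfun)) => w /GF /=.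
by rewrite lext_word.
Qed.

Lemma invertible_id n : invertible_upto n word.
Proof.
have fw : filtered word by move=> w; apply: span_word.
by exists word; apply: inverse_uptoI => // w _; rewrite lext_word.
Qed.

Lemma eq_invertible n F F' : filtered F' ->
  (forall w, (size w <= n)%N -> F w = F' w) ->
  invertible_upto n F -> invertible_upto n F'.
Proof.
move=> fF' eF [G [fF fG FG GF]]; exists G.
have eqF f : upto n f -> lext F' f = lext F f.
  by apply: eq_linear_span => w le_w; rewrite !lext_word eF.
split=> // f Wf; first by rewrite eqF ?FG //; apply: lext_upto.
by rewrite eqF ?GF.
Qed.

Lemma lext_comp F F' f : lext (fun w => lext F (F' w)) f = lext F (lext F' f).
Proof.
by apply: (eq_linear (M := lext F \o lext F')) => w /=; rewrite !lext_word.
Qed.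

Lemma invertible_comp n F F' : invertible_upto n F -> invertible_upto n F' ->
  invertible_upto n (fun w => lext F (F' w)).
Proof.
move=> [G [fF fG FG GF]] [G' [fF' fG' FG' GF']].
exists (fun w => lext G' (G w)); apply: inverse_uptoI => w.
- exact/lext_upto/fF'.
- exact/lext_upto/fG.
- move=> le_w.
  rewrite lext_comp.
  have Ww : upto n (word w) by apply: span_word.
  by rewrite FG' -1?[G w]lext_word ?FG //; apply: lext_upto.
- move=> le_w.
  rewrite lext_comp.
  have Ww : upto n (word w) by apply: span_word.
  by rewrite GF -1?[F' w]lext_word ?GF' //; apply: lext_upto.
Qed.

(** From F B = C follows B = F^-1 C. This is how 1 - R_0 is divided out. *)
Lemma invertible_cancel n F B C : filtered B ->
  (forall w, (size w <= n)%N -> lext F (B w) = C w) ->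
  invertible_upto n F -> invertible_upto n C -> invertible_upto n B.
Proof.
move=> fB eC [G [fF fG FG GF]] iC.
apply: eq_invertible (invertible_comp (F := G) _ iC) => // [w le_w|].
  by rewrite -eC // GF //; apply: uptoW le_w (fB w).
by exists F.
Qed.

(** The family may depend on the first letter because 1 - Y acts on the tail of a v by 1 -
    R_{2|a|}. *)
Definition lmap (F : A -> seq A -> V) w : V :=
  if w is a :: v then cons0 (Some a) (F a v) else word [::].

Lemma cons0_upto n x f : upto n f -> upto n.+1 (cons0 x f).
Proof.
apply: span_linear => w le_w; case: x => [a|]; last first.
  by rewrite cons0_None; apply: span0.
by rewrite cons0_word; apply: span_word.
Qed.

Lemma filtered_lmap (F : A -> seq A -> V) :
  (forall a, filtered (F a)) -> filtered (lmap F).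
Proof. by move=> fF [|a w]; [apply: span_word | apply/cons0_upto/fF]. Qed.

Lemma lext_lmap (F : A -> seq A -> V) a f :
  lext (lmap F) (cons0 (Some a) f) = cons0 (Some a) (lext (F a) f).
Proof.
apply: (eq_linear (L := lext _ \o cons0 _) (M := cons0 _ \o lext _)) => w /=.
by rewrite cons0_word !lext_word.
Qed.

(** The tails are inverted separately for each first letter; that letter is untouched, so the length
    bound grows by one. *)
Lemma invertible_lmap n (F : A -> seq A -> V) :
  (forall a, invertible_upto n (F a)) -> invertible_upto n.+1 (lmap F).
Proof.
move=> /choice [G iG]; exists (lmap G).
apply: inverse_uptoI; first by apply: filtered_lmap => a; case: (iG a).
- by apply: filtered_lmap => a; case: (iG a).
- move=> [|a w] le_w; first by rewrite lext_word.
  have [_ _ FG _] := iG a.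
  rewrite lext_lmap -[G a w]lext_word FG ?cons0_word //.
  exact: span_word.
- move=> [|a w] le_w; first by rewrite lext_word.
  have [_ _ _ GF] := iG a.
  rewrite lext_lmap -[F a w]lext_word GF ?cons0_word //.
  exact: span_word.
Qed.

(** The mirror image of [lmap], keeping the last letter; it turns B into B'. *)
Definition rmap F w : V :=
  if w is a :: v then snoc (last a v) (F (belast a v)) else word [::].

Lemma rmap_rcons F w a : rmap F (rcons w a) = snoc a (F w).
Proof. by case: w => //= b w; rewrite last_rcons belast_rcons. Qed.

Lemma filtered_rmap F : filtered F -> filtered (rmap F).
Proof.
move=> fF; elim/last_ind=> [|w a _]; first exact: span_word.
rewrite rmap_rcons size_rcons; apply: span_linear (fF w) => v le_v.
by rewrite snoc_word; apply: span_word; rewrite size_rcons.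
Qed.

Lemma lext_rmap F a f : lext (rmap F) (snoc a f) = snoc a (lext F f).
Proof.
apply: (eq_linear (L := lext _ \o snoc _) (M := snoc _ \o lext _)) => w /=.
by rewrite snoc_word !lext_word rmap_rcons.
Qed.

Lemma invertible_rmap n F :
  invertible_upto n F -> invertible_upto n.+1 (rmap F).
Proof.
move=> [G [fF fG FG GF]]; exists (rmap G).
apply: inverse_uptoI; [exact: filtered_rmap | exact: filtered_rmap | |].
- elim/last_ind=> [|w a _] le_w; first by rewrite lext_word.
  rewrite rmap_rcons lext_rmap -[G w]lext_word FG ?snoc_word //.
  by apply: span_word; rewrite size_rcons in le_w.
- elim/last_ind=> [|w a _] le_w; first by rewrite lext_word.
  rewrite rmap_rcons lext_rmap -[F w]lext_word GF ?snoc_word //.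
  by apply: span_word; rewrite size_rcons in le_w.
Qed.

Definition lowers F : Prop :=
  forall w, span (fun v => (size v < size w)%N) (F w).

Lemma lext_lowers n F f : lowers F -> upto n.+1 f -> upto n (lext F f).
Proof.
move=> lF; apply: span_linear => w le_w; rewrite lext_word.
by apply: span_sub (lF w) => v lt_v; rewrite -ltnS (leq_trans lt_v).
Qed.

Lemma lowers_filtered F : lowers F -> filtered F.
Proof. by move=> lF w; apply: span_sub (lF w) => v /ltnW. Qed.

(* If G inverts B + N on words of length <= n and H inverts B on words of
   length <= n + 1, then H - G N H inverts B + N on the latter. *)
Lemma invertible_perturb B N : lowers N ->
  (forall n, invertible_upto n B) ->
  forall n, invertible_upto n (fun w => B w + N w).
Proof.
move=> lN iB; set F := fun w => B w + N w.
have lextF f : lext F f = lext B f + lext N f.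
  by apply: (eq_linear (M := lext B \+ lext N)) => w /=; rewrite !lext_word.
have fF : filtered F.
  move=> w; case: (iB 0%N) => G [fB _ _ _].
  by apply: spanD (fB w) (lowers_filtered lN w).
elim=> [|n [G [_ fG FG GF]]].
  apply: eq_invertible (iB 0%N) => // -[|//] _.
  (* No word has negative length, so N kills the empty word. *)
  suff N0 f : span (fun v => (size v < 0)%N) f -> f = 0.
    by rewrite /F (N0 _ (lN [::])) addr0.
  by case.
have [H [fB fH BH HB]] := iB n.+1.
pose G' w := H w - lext G (lext N (H w)).
have lextG' f : lext G' f = lext H f - lext G (lext N (lext H f)).
  rewrite (eq_linear (M := lext H \- (lext G \o (lext N \o lext H)))) //.
  by move=> w /=; rewrite !lext_word.
have fN f : upto n.+1 f -> upto n (lext N f) by apply: lext_lowers.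
(* (B + N)(H - G N H) = B H + N H - N H, because N H f has length at most n, where G is a right
   inverse of B + N. *)
have FG' f : upto n.+1 f -> lext F (lext G' f) = f.
  move=> Wf; have WH : upto n.+1 (lext H f) by apply: lext_upto.
  by rewrite lextG' linearB /= FG ?lextF ?BH ?addrK //; apply: fN.
have fG' : filtered G'.
  by move=> w; apply: spanB (fH w) _; do !apply: lext_upto => //;
    apply: lowers_filtered.
exists G'; split=> // f Wf; rewrite lextF linearD /=.
have WN := fN _ Wf; have WN' := uptoW (leqnSn n) WN.
(* On length at most n, G' agrees with G, since F G' = 1 and G F = 1 there. *)
have -> : lext G' (lext N f) = lext G (lext N f).
  rewrite -[in RHS](FG' _ WN') GF //.
  rewrite lextG'; apply: spanB; first exact: lext_upto.
  apply: lext_upto => //; apply: fN; exact: lext_upto.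
by rewrite lextG' HB // subrK.
Qed.

Lemma invertible_inj F : (forall n, invertible_upto n F) -> injective (lext F).
Proof.
move=> iF f g eFfg; have [m Wf] := upto_ex f; have [n Wg] := upto_ex g.
have [G [_ _ _ GF]] := iF (maxn m n).
have <- : lext G (lext F f) = f by apply/GF/uptoW/Wf/leq_maxl.
by rewrite eFfg; apply/GF/uptoW/Wg/leq_maxr.
Qed.

(** The inverses for different n are not known to be compatible: a preimage is chosen for each f,
    and injectivity makes this right inverse two-sided. *)
Lemma invertible_bij F : (forall n, invertible_upto n F) -> bijective (lext F).
Proof.
move=> iF.
have /choice[G FG] f : exists g, lext F g = f.
  have [n Wf] := upto_ex f; have [G [_ _ FG _]] := iF n.
  by exists (lext G f); apply: FG.
by exists G => // f; apply: (invertible_inj iF); rewrite FG.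
Qed.

End WordBasis.

(** * Insertion of the first letter and the rotation identity *)

Section Insertion.
Context (k : fieldType) (A : choiceType).
Context (V : lmodType k) (word : basis (seq A) V).
Context (deg : A -> nat) (q : k).
Local Notation lext := (lext word).
Local Notation cons0 := (cons0 word).
Local Notation snoc := (snoc word).
Local Notation wdeg := (wdeg deg).
Implicit Types (f g : V) (u v w : seq A) (a b : A) (d : nat).

Lemma wdeg_cons a w : wdeg (a :: w) = (deg a + wdeg w)%N.
Proof. by rewrite /wdeg big_cons. Qed.

Lemma wdeg_cat u v : wdeg (u ++ v) = (wdeg u + wdeg v)%N.
Proof. by rewrite /wdeg big_cat. Qed.

Lemma wdeg_rcons w a : wdeg (rcons w a) = (deg a + wdeg w)%N.
Proof. by rewrite -cats1 wdeg_cat /wdeg big_seq1 addnC. Qed.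

Fixpoint ins a w : V :=
  if w is b :: v then
    word (a :: w) + q ^+ (deg a * deg b) *: cons0 (Some b) (ins a v)
  else word [:: a].

(** Either [a] goes before the last letter or to the very end. Isolating the end term allows
    comparison with [rmap]. *)
Lemma ins_rcons a w b : ins a (rcons w b) =
  snoc b (ins a w)
  + q ^+ (deg a * wdeg (rcons w b)) *: word (rcons (rcons w b) a).
Proof.
elim: w => [|b' w IH] /=.
  by rewrite snoc_word cons0_word wdeg_cons /wdeg big_nil addn0.
rewrite IH !linearD !linearZ /= snoc_word snoc_cons0 cons0_word -addrA.
by rewrite scalerA -exprD -mulnDr wdeg_cons addnC.
Qed.

(** The common degree of all terms matters: the weight of a rotation depends only on the degree of
    what the letter is moved past. *)
Lemma ins_span a w :
  span word (fun v => size v = (size w).+1 /\ wdeg v = (deg a + wdeg w)%N)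
    (ins a w).
Proof.
elim: w => [|b w IH] /=; first by apply: span_word; rewrite wdeg_cons.
apply: spanD; first by apply: span_word; rewrite wdeg_cons.
apply/spanZ; apply: span_linear IH => v [sv dv].
rewrite cons0_word; apply: span_word; rewrite /= sv !wdeg_cons dv; split=> //.
by rewrite addnCA.
Qed.

(** The map B, read as a map on words a v. *)
Definition insert_head w : V := if w is a :: v then ins a v else word [::].

Lemma filtered_insert_head : filtered word insert_head.
Proof.
case=> [|a w]; first exact: span_word.
by apply: span_sub (ins_span a w) => v [-> _].
Qed.

(* For d = 0 a word of length 1 is sent to 0 instead of itself, so that
   1 - rot1 d is always invertible. *)
Definition rot1 d w : V :=
  if w is a :: v then
    if (d == 0%N) && nilp v then 0
    else q ^+ (deg a * (wdeg v + d)) *: word (rcons v a)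
  else 0.

Definition unrot d w : V := word w - rot1 d w.

Lemma lext_unrot d f : lext (unrot d) f = f - lext (rot1 d) f.
Proof.
apply: (eq_linear (word := word) (L := lext _) 
  (M := idfun \- lext (rot1 d))) => w /=.
by rewrite !lext_word.
Qed.

(** All words of [ins a w] are nonempty, so the convention for single letters does not interfere,
    and they share one degree, so the factor is common. *)
Lemma rot1_cons0_ins a b w :
  lext (rot1 0) (cons0 (Some b) (ins a w)) =
    q ^+ (deg b * (deg a + wdeg w)) *: snoc b (ins a w).
Proof.
apply: (eq_linear_span (L := lext (rot1 0) \o cons0 _)
  (M := q ^+ (deg b * (deg a + wdeg w)) \*: snoc b) _ (ins_span a w)).
move=> [|c v] [//] _ dv /=.
rewrite cons0_word.
by rewrite lext_word snoc_word /= dv addn0.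
Qed.

(* Rotating the word in ins a w that has a in front gives the one that has a
   at the end, and all other words of ins a (b :: w) start with b. *)
Lemma unrot_insert_head w : (forall a, (0 < deg a)%N) ->
  lext (unrot 0) (insert_head w) =
    lext (rmap word insert_head) (lmap word (fun a => unrot (deg a).*2) w).
Proof.
move=> deg_gt0; case: w => [|a [|b w]].
- by rewrite /= !lext_word /unrot subr0.
- rewrite /= lext_word /unrot !subr0 cons0_word lext_word.
  by rewrite (rmap_rcons _ _ [::]) snoc_word.
(* The shift 2|a| arises here: one |a||b| is the weight of inserting [a] after [b], the other comes
   from rotating [b] past [a]. *)
have rot_ins : lext (rot1 0) (ins a (b :: w)) =
    q ^+ (deg a * wdeg (b :: w)) *: word (rcons (b :: w) a) +
    q ^+ (deg b * (wdeg w + (deg a).*2)) *: snoc b (ins a w).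
  rewrite /= linearD linearZ /= rot1_cons0_ins lext_word /= addn0.
  rewrite scalerA -exprD.
  by congr (_ + q ^+ _ *: _); lia.
have lmap_unrot : lmap word (fun a => unrot (deg a).*2) (a :: b :: w) =
    word (a :: b :: w) -
    q ^+ (deg b * (wdeg w + (deg a).*2)) *: word (rcons (a :: w) b).
  rewrite /= /unrot /= double_eq0 eqn0Ngt deg_gt0 /=.
  by rewrite linearB linearZ /= !cons0_word.
have rmap1 : lext (rmap word insert_head) (word (rcons (a :: w) b)) =
    snoc b (ins a w) by rewrite lext_word rmap_rcons.
(* Keeping the last letter fixed loses exactly the term with [a] at the end. *)
have rmap2 : lext (rmap word insert_head) (word (a :: b :: w)) =
    ins a (b :: w) - q ^+ (deg a * wdeg (b :: w)) *: word (rcons (b :: w) a).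
  have : b :: w <> [::] by [].
  rewrite lext_word; case/lastP: (b :: w) => [//|u c] _.
  by rewrite ins_rcons addrK -rcons_cons rmap_rcons.
have linBZ (L : {linear V -> V}) c f g : L (f - c *: g) = L f - c *: L g.
  by rewrite linearB linearZ.
by rewrite lmap_unrot lext_unrot rot_ins linBZ rmap1 rmap2 opprD addrA.
Qed.

(** * Powers of the rotation and the inverse of 1 - R_d *)

Definition rot_weight n w : nat := (\sum_(a <- w) deg a * (n - deg a))%N.

(** For n = |w| + d, each letter contributes the exponent of moving it past all the others. The sum
    ignores their order, so all rotations of a word share it. *)
Lemma rot_weight_rcons n w a : rot_weight n (rcons w a) = rot_weight n (a :: w).
Proof. by rewrite /rot_weight -cats1 big_cat big_seq1 big_cons addnC. Qed.

Definition rotatable d w : bool :=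
  (0 < d)%N && (0 < size w)%N || (1 < size w)%N.

Lemma rot1_cons d a w : rotatable d (a :: w) ->
  rot1 d (a :: w) = q ^+ (deg a * (wdeg w + d)) *: word (rcons w a).
Proof. by rewrite /rotatable /=; case: w => [|b w]; case: d. Qed.

Lemma rot1_eq0 d w : ~~ rotatable d w -> rot1 d w = 0.
Proof. by case: w => [|a [|b w]] //; case: d. Qed.

(** The prefix [u] moves to the end letter by letter, and the total degree stays fixed. With [v]
    empty, R_d^n is a scalar on a word of length n. *)
Lemma iter_rot1 d u v : rotatable d (u ++ v) ->
  iter (size u) (lext (rot1 d)) (word (u ++ v)) =
    q ^+ rot_weight (wdeg (u ++ v) + d) u *: word (v ++ u).
Proof.
elim: u v => [|a u IH] v; first by rewrite /rot_weight big_nil scale1r cats0.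
rewrite cat_cons => rot_w; rewrite [size _]/= iterSr lext_word rot1_cons //.
have iterZ n c f :
    iter n (lext (rot1 d)) (c *: f) = c *: iter n (lext (rot1 d)) f.
  by elim: n => //= n ->; rewrite linearZ.
rewrite iterZ rcons_cat IH; last first.
  by rewrite /rotatable size_cat size_rcons addnS -size_cat.
rewrite cat_rcons scalerA -exprD /rot_weight big_cons wdeg_cons.
congr (q ^+ _ *: _); rewrite -rcons_cat wdeg_rcons; congr (_ * _ + _)%N.
by rewrite -addnA addKn.
Qed.

Definition rot_sum d n f : V := \sum_(i < n) iter i (lext (rot1 d)) f.

Lemma rot_sum_is_linear d n : linear (rot_sum d n).
Proof.
move=> c f g; rewrite /rot_sum scaler_sumr -big_split; apply: eq_bigr => i _ /=.
by elim: (nat_of_ord i) => //= m ->; rewrite linearP.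
Qed.

HB.instance Definition _ d n :=
  GRing.isLinear.Build k V V *:%R (rot_sum d n) (rot_sum_is_linear d n).

Lemma rot_sum_rot1 d n f :
  rot_sum d n (lext (rot1 d) f) = lext (rot1 d) (rot_sum d n f).
Proof.
by rewrite /rot_sum linear_sum; apply: eq_bigr => i _; rewrite -iterSr.
Qed.

Lemma rot_sum_sub d n f :
  rot_sum d n f - lext (rot1 d) (rot_sum d n f) = f - iter n (lext (rot1 d)) f.
Proof.
elim: n => [|n IH]; first by rewrite /rot_sum big_ord0 linear0 !subrr.
rewrite /rot_sum big_ord_recr -/(rot_sum d n f) linearD opprD addrACA IH /=.
by rewrite addrA subrK.
Qed.

(* 1 - rot1 d = 1 - R is inverted on words of length n by
   (1 + R + ... + R^(n-1)) / (1 - q^N), since R^n = q^N there. *)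
Definition unrot_inv d w : V :=
  if rotatable d w then
    (1 - q ^+ rot_weight (wdeg w + d) w)^-1 *: rot_sum d (size w) (word w)
  else word w.

Context (deg_gt0 : forall a, (0 < deg a)%N).
Context (q_pow : forall n, (0 < n)%N -> q ^+ n != 1).

(** For a word a u the first letter alone contributes |a|(|u| + d), and either d > 0 or u is
    nonempty. *)
Lemma rot_weight_gt0 d w : rotatable d w -> (0 < rot_weight (wdeg w + d) w)%N.
Proof.
case: w => [|a w]; first by rewrite /rotatable /= andbF.
rewrite /rot_weight big_cons wdeg_cons -addnA addKn => rot_w.
rewrite addn_gt0 muln_gt0 deg_gt0 addn_gt0 /=.
move: rot_w; rewrite /rotatable /= andbT => /orP[->|]; first by rewrite orbT.
by case: w => // b w _; rewrite wdeg_cons addn_gt0 deg_gt0.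
Qed.

Lemma upto_rot1 d : filtered word (rot1 d).
Proof.
case=> [|a w] /=; first exact: span0.
case: ifP => _; first exact: span0.
by apply/spanZ/span_word; rewrite size_rcons.
Qed.

Lemma filtered_unrot d : filtered word (unrot d).
Proof. by move=> w; apply: spanB (upto_rot1 d w); apply: span_word. Qed.

Lemma filtered_unrot_inv d : filtered word (unrot_inv d).
Proof.
move=> w; rewrite /unrot_inv; case: ifP => _; last exact: span_word.
apply: spanZ; rewrite /rot_sum; elim/big_ind: _ => [|f g|i _].
- exact: span0.
- exact: spanD.
elim: (nat_of_ord i) => [|m IH] /=; first exact: span_word.
by apply: lext_upto => //; apply: upto_rot1.
Qed.

Lemma unrot_invertible d n : invertible_upto word n (unrot d).
Proof.
exists (unrot_inv d); apply: inverse_uptoI => [||w _|w _].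
- exact: filtered_unrot.
- exact: filtered_unrot_inv.
- rewrite lext_unrot /unrot_inv; have [rot_w|rot'w] := ifP; last first.
    by rewrite lext_word rot1_eq0 ?rot'w ?subr0.
  rewrite linearZ /= -scalerBr rot_sum_sub.
  have := @iter_rot1 d w [::]; rewrite cats0 => -> //=.
  rewrite -{1}[word w]scale1r -scalerBl scalerA mulVf ?scale1r //.
  by rewrite subr_eq0 eq_sym q_pow // rot_weight_gt0.
- rewrite /unrot linearB /= lext_word.
  have [rot_w|rot'w] := boolP (rotatable d w); last first.
    by rewrite rot1_eq0 // linear0 subr0 /unrot_inv (negbTE rot'w).
  (* The candidate inverse commutes with R_d: a word and its rotation have the same length and the
     same scalar, named [N] below. So the telescoping of the right inverse also serves on the
     left. *)
  have -> : lext (unrot_inv d) (rot1 d w) = lext (rot1 d) (unrot_inv d w).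
    case: w rot_w => [|a w] rot_w; first
      by rewrite /rotatable /= andbF in rot_w.
    have rot_w' : rotatable d (rcons w a) by rewrite /rotatable size_rcons.
    have [N NE] :
        {N | N = (1 - q ^+ rot_weight (wdeg (a :: w) + d) (a :: w))^-1}.
      by eexists.
    transitivity (N *: rot_sum d (size (a :: w)) (rot1 d (a :: w))).
      rewrite rot1_cons // !linearZ lext_word /unrot_inv rot_w' wdeg_rcons.
      by rewrite rot_weight_rcons size_rcons -wdeg_cons -NE /= !scalerA mulrC.
    by rewrite /unrot_inv rot_w -NE linearZ /= -rot_sum_rot1 lext_word.
  rewrite /unrot_inv rot_w linearZ /= -scalerBr rot_sum_sub.
  have := @iter_rot1 d w [::]; rewrite cats0 => -> //=.
  rewrite -{1}[word w]scale1r -scalerBl scalerA mulVf ?scale1r //.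
  by rewrite subr_eq0 eq_sym q_pow // rot_weight_gt0.
Qed.

(** Induction through (1 - R_0) B = B' (1 - Y): B' is invertible one length higher by the induction
    hypothesis, and both other factors through [unrot_invertible]. *)
Lemma insert_head_invertible n : invertible_upto word n insert_head.
Proof.
elim: n => [|n IH].
  apply: eq_invertible (invertible_id word 0).
    exact: filtered_insert_head.
  by case.
have iY := invertible_lmap (fun a => unrot_invertible (deg a).*2 n).
apply: invertible_cancel (invertible_comp (invertible_rmap IH) iY).
- exact: filtered_insert_head.
- by move=> w _; apply: unrot_insert_head.
- exact: unrot_invertible.
Qed.

End Insertion.

(** * Associativity of the quasi-shuffle product and inversion of Phi *)

Section QuasiShuffle.
Context (k : fieldType) (A : choiceType).
Context (V : lmodType k) (word : basis (seq A) V).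
Context (deg : A -> nat) (br : option A -> option A -> option A) (q : k).
Context (S0 : forall x, br x None = None) (S1 : forall x y, br x y = br y x).
Context (S2 : forall x y z, br (br x y) z = br x (br y z)).
Context (S3 : forall a b, br (Some a) (Some b) = None \/
  exists2 c, br (Some a) (Some b) = Some c & deg c = (deg a + deg b)%N).
Local Notation lext := (lext word).
Local Notation cons0 := (cons0 word).
Local Notation word_ind := (@word_ind k A V word).
Local Notation wdeg := (wdeg deg).
Implicit Types (f g h : V) (u v w : seq A) (a b : A) (x y z : option A).
Implicit Types (c r s : k) (F G : seq A -> V).

Fixpoint qshw u : seq A -> V :=
  fix qsh_u v : V :=
    match u, v with
    | [::], _ => word v
    | _, [::] => word u
    | a :: w1, b :: w2 =>
        cons0 (Some a) (qshw w1 v)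
        + q ^+ (wdeg u * deg b) *: cons0 (Some b) (qsh_u w2)
        + q ^+ (wdeg w1 * deg b) *: cons0 (br (Some a) (Some b)) (qshw w1 w2)
    end.

Definition qshe f g : V := lext (fun u => lext (qshw u) g) f.

Lemma qshDl f g h : qshe (f + g) h = qshe f h + qshe g h.
Proof. exact: linearD. Qed.
Lemma qshZl c f g : qshe (c *: f) g = c *: qshe f g.
Proof. exact: linearZ. Qed.
Lemma qsh0l f : qshe 0 f = 0.
Proof. exact: linear0. Qed.

Lemma qsh_linr f : linear (qshe f).
Proof.
move=> c g h; elim/word_ind: f => [|d w f IH].
  by rewrite !qsh0l scaler0 addr0.
rewrite !qshDl !qshZl {}IH /qshe !lext_word linearP !scalerDr !scalerA mulrC.
by rewrite addrACA.
Qed.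

HB.instance Definition _ f :=
  GRing.isLinear.Build k V V *:%R (qshe f) (qsh_linr f).

Lemma qshDr f g h : qshe f (g + h) = qshe f g + qshe f h.
Proof. exact: linearD. Qed.
Lemma qshZr c f g : qshe f (c *: g) = c *: qshe f g.
Proof. exact: linearZ. Qed.
Lemma qsh0r f : qshe f 0 = 0.
Proof. exact: linear0. Qed.

Lemma qsh_words u v : qshe (word u) (word v) = qshw u v.
Proof. by rewrite /qshe !lext_word. Qed.

Lemma qsh1l f : qshe (word [::]) f = f.
Proof.
by apply: (eq_linear (word := word) (L := qshe _) (M := idfun)) => -[|a w];
  exact: qsh_words.
Qed.

Lemma qsh1r f : qshe f (word [::]) = f.
Proof.
by apply: (eq_linear (word := word) (L := lext _) (M := idfun)) => -[|a w];
  exact: qsh_words.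
Qed.

(* The exponents of q in the recursion for [qshe] depend on the degree of the
   left-hand word; the twist by r = q^|b| makes the recursion linear. *)
Definition twist r : {linear V -> V} := lext (fun w => r ^+ wdeg w *: word w).

Definition deg0 x : nat := oapp deg 0 x.

Lemma twist_word r w : twist r (word w) = r ^+ wdeg w *: word w.
Proof. exact: lext_word. Qed.

Lemma twistM r s f : twist r (twist s f) = twist (r * s) f.
Proof.
apply: (eq_linear (word := word) (L := twist r \o twist s)) => w /=.
by rewrite !twist_word linearZ /= twist_word scalerA exprMn mulrC.
Qed.

Lemma twist_cons0 r x f :
  twist r (cons0 x f) = r ^+ deg0 x *: cons0 x (twist r f).
Proof.
case: x => [a|]; last by rewrite !cons0_None linear0 scaler0.
apply: (eq_linear (word := word) (L := twist r \o cons0 _)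
  (M := r ^+ deg a \*: (cons0 _ \o twist r))) => w /=.
by rewrite cons0_word !twist_word linearZ /= cons0_word wdeg_cons exprD scalerA.
Qed.

Lemma br0 x : br None x = None. Proof. by rewrite S1. Qed.

(** Allowing the zero letter and arbitrary polynomials lets bracket terms be fed back into the
    recursion without case distinction. *)
Lemma qsh_cons0 x y f g :
  qshe (cons0 x f) (cons0 y g) =
    cons0 x (qshe f (cons0 y g))
    + cons0 y (qshe (twist (q ^+ deg0 y) (cons0 x f)) g)
    + cons0 (br x y) (qshe (twist (q ^+ deg0 y) f) g).
Proof.
case: x => [a|]; last by rewrite br0 !cons0_None !linear0 !qsh0l linear0 !addr0.
case: y => [b|]; last by rewrite S0 !cons0_None !qsh0r linear0 !addr0.
elim/word_ind: f => [|c u f IH].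
  by rewrite !(qsh0l, linear0) !addr0.
rewrite !(linearD, qshDl) IH /=.
rewrite [RHS](AC (2*2*2) ((1*3*5)*(2*4*6)))/=; congr (_ + _) => {IH f}.
rewrite !(linearZ, qshZl) /= -!scalerDr; congr (_ *: _).
elim/word_ind: g => [|d v g IH].
  by rewrite !(qsh0r, linear0) !addr0.
rewrite !(linearD, qshDr) /= IH.
rewrite [RHS](AC (2*2*2) ((1*3*5)*(2*4*6)))/=; congr (_ + _) => {IH g}.
rewrite !(linearZ, qshZr) /= -!scalerDr; congr (_ *: _).
rewrite !cons0_word !twist_word !(linearZ, qshZl) /= !qsh_words /=.
by rewrite -!exprM ![(deg b * _)%N]mulnC.
Qed.

Lemma twistC r s f : twist r (twist s f) = twist s (twist r f).
Proof. by rewrite !twistM mulrC. Qed.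

Lemma deg0_br x y : br x y = None \/ deg0 (br x y) = (deg0 x + deg0 y)%N.
Proof.
case: x => [a|]; last by rewrite br0; left.
case: y => [b|]; last by rewrite S0; left.
by have [->|[c -> /= ->]] := S3 a b; [left|right].
Qed.

(** By (S3) the degrees add unless the bracket is 0, and then both sides vanish. *)
Lemma twist_br r x y f :
  twist r (cons0 (br x y) f) =
    r ^+ (deg0 x + deg0 y) *: cons0 (br x y) (twist r f).
Proof.
rewrite twist_cons0.
by have [->|->] := deg0_br x y; rewrite ?cons0_None ?scaler0.
Qed.

Lemma twist_qsh_cons0 r x y f g (s := q ^+ deg0 y)
    (T := fun f g => twist r (qshe f g) = qshe (twist r f) (twist r g)) :
  T f (cons0 y g) -> T (twist s (cons0 x f)) g -> T (twist s f) g ->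
  T (cons0 x f) (cons0 y g).
Proof.
rewrite /T => T1 T2 T3; rewrite qsh_cons0 -/s !linearD /= twist_br.
rewrite (twist_cons0 r x) (twist_cons0 r y) T1 T2 T3 !(twistC r s).
rewrite !twist_cons0 !(qshZl, qshZr, linearZ) /= qsh_cons0 -/s.
rewrite !twist_cons0 !(linearZ, qshZl) /= !scalerDr !scalerA.
rewrite ?(twistC r s) exprD.
by congr (_ + _ + _); congr (_ *: _); rewrite // mulrC mulrA.
Qed.

(** The product is graded, so scaling by r^degree is multiplicative. The proof is by induction on
    total length. *)
Lemma twist_qsh r f g : twist r (qshe f g) = qshe (twist r f) (twist r g).
Proof.
suff tw n u v : (size u + size v <= n)%N ->
    twist r (qshe (word u) (word v)) =
    qshe (twist r (word u)) (twist r (word v)).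
  apply: (eq_linear (word := word) (L := twist r \o qshe f)
    (M := qshe (twist r f) \o twist r)) => v.
  apply: (eq_linear (word := word) (L := twist r \o lext _)
    (M := lext _ \o twist r)) => u /=.
  by have := tw _ u v (leqnn _); rewrite /qshe lext_word.
have tw1 : twist r (word [::]) = word [::].
  by rewrite twist_word /wdeg big_nil expr0 scale1r.
elim: n u v => [|n IH] [|a u] [|b v] //; rewrite ?(qsh1l, qsh1r, tw1) //.
rewrite /= addSn ltnS => le_n.
rewrite -(cons0_word word a) -(cons0_word word b).
apply: twist_qsh_cons0; rewrite ?cons0_word.
- by rewrite IH.
- rewrite twist_word !(linearZ, qshZl) /= IH //=.
  by move: le_n; rewrite addnS addSn.
- rewrite twist_word !(linearZ, qshZl) /= IH //=.
  by rewrite (leq_trans _ le_n) // leq_add2l.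
Qed.

(** The seven hypotheses match the possible leading letters of the triple product, in the order x,
    y, z, [x,y], [x,z], [y,z], [[x,y],z]. *)
Lemma qshA_cons0 x y z f g h (s := q ^+ deg0 y) (t := q ^+ deg0 z)
    (T := fun f g h => qshe (qshe f g) h = qshe f (qshe g h))
    (F := cons0 x f) (G := cons0 y g) (H := cons0 z h) :
  T f G H -> T (twist s F) g H -> T (twist t F) (twist t G) h ->
  T (twist s f) g H -> T (twist t f) (twist t G) h ->
  T (twist t (twist s F)) (twist t g) h ->
  T (twist t (twist s f)) (twist t g) h ->
  T F G H.
Proof.
rewrite /T => T1 T2 T3 T4 T5 T6 T7.
have FG : qshe F G = cons0 x (qshe f G) + cons0 y (qshe (twist s F) g)
    + cons0 (br x y) (qshe (twist s f) g) by exact: qsh_cons0.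
have GH : qshe G H = cons0 y (qshe g H) + cons0 z (qshe (twist t G) h)
    + cons0 (br y z) (qshe (twist t g) h) by exact: qsh_cons0.
rewrite {1}FG !qshDl !qsh_cons0 -/t -/H T1 T2 T4 !twist_qsh T5 T6 T7.
(* On the left, z leads three separate terms; together they form the expansion of one product, to
   which [T3] applies. *)
have := T3; rewrite -twist_qsh FG !linearD !qshDl /= => T3'.
have FH z' h' : qshe F (cons0 z' h') = cons0 x (qshe f (cons0 z' h'))
    + cons0 z' (qshe (twist (q ^+ deg0 z') F) h')
    + cons0 (br x z') (qshe (twist (q ^+ deg0 z') f) h') by exact: qsh_cons0.
rewrite GH !qshDr !FH -/s -/t -/F -/G -T3' !linearD /= S2.
have -> : cons0 (br y z)
    (qshe (twist (q ^+ deg0 (br y z)) F) (qshe (twist t g) h)) =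
    cons0 (br y z) (qshe (twist t (twist s F)) (qshe (twist t g) h)).
  have [->|->] := deg0_br y z; first by rewrite !cons0_None.
  by rewrite twistM addnC exprD.
have -> : cons0 (br x (br y z))
    (qshe (twist (q ^+ deg0 (br y z)) f) (qshe (twist t g) h)) =
    cons0 (br x (br y z)) (qshe (twist t (twist s f)) (qshe (twist t g) h)).
  have [->|->] := deg0_br y z; first by rewrite S0 !cons0_None.
  by rewrite twistM addnC exprD.
(* The terms are grouped by the three summands of G H; the middle group collects the three terms led
   by z. *)
by rewrite [LHS](AC ((3*1*1)*3*3) ((1*6*9)*(2*(4*7*10)*5)*(3*8*11))).
Qed.

Lemma qshA f g h : qshe (qshe f g) h = qshe f (qshe g h).
Proof.
suff qA n u v w : (size u + size v + size w <= n)%N ->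
    qshe (qshe (word u) (word v)) (word w) =
    qshe (word u) (qshe (word v) (word w)).
  elim/word_ind: f => [|c u f IH]; first by rewrite !qsh0l.
  rewrite !(qshDl, qshZl) {}IH; congr (_ *: _ + _).
  elim/word_ind: g => [|d v g IH]; first by rewrite !(qsh0l, qsh0r).
  rewrite !(qshDl, qshDr, qshZl, qshZr) {}IH; congr (_ *: _ + _).
  elim/word_ind: h => [|e w h IH]; first by rewrite !qsh0r.
  rewrite !(qshDr, qshZr) {}IH; congr (_ *: _ + _).
  exact: qA (leqnn _).
elim: n u v w => [|n IH] [|a u] [|b v] [|c w] //; rewrite ?(qsh1l, qsh1r) //.
rewrite /= !addSn ltnS => le_n.
rewrite -(cons0_word word a) -(cons0_word word b) -(cons0_word word c).
apply: qshA_cons0; rewrite ?cons0_word ?(twist_word, linearZ) /=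
  ?(twist_word, qshZl, qshZr) IH //=.
all: by [move: le_n; lia | rewrite !scalerA mulrC].
Qed.

Definition Phiw w : V := foldl (fun f a => qshe f (word [:: a])) (word [::]) w.

Lemma Phiw_cat u v : Phiw (u ++ v) = qshe (Phiw u) (Phiw v).
Proof.
rewrite /Phiw foldl_cat; elim/last_ind: v => [|v a IH]; first
  by rewrite /= qsh1r.
by rewrite !foldl_rcons IH qshA.
Qed.

(** The argument on the left is concatenation in the form given by [mul_ncpolyE]. *)
Lemma Phiw_mul f g :
  lext Phiw (lext (fun u => lext (fun v => word (u ++ v)) g) f) =
    qshe (lext Phiw f) (lext Phiw g).
Proof.
elim/word_ind: f => [|c u f IH]; first by rewrite !linear0 qsh0l.
rewrite !linearP /= qshDl qshZl {}IH; congr (_ *: _ + _); rewrite !lext_word.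
apply: (eq_linear (word := word) (L := lext Phiw \o lext _)
  (M := qshe (Phiw u) \o lext Phiw)) => v /=.
by rewrite !lext_word Phiw_cat.
Qed.

(** The map L: a v |-> a * v. *)
Definition qsh_head w : V := if w is a :: v then qshw [:: a] v else word [::].

Lemma Phiw_cons a w : Phiw (a :: w) = lext qsh_head (cons0 (Some a) (Phiw w)).
Proof.
rewrite -cat1s Phiw_cat {1}/Phiw /= qsh1l.
apply: (eq_linear (word := word) (L := qshe _)
  (M := lext _ \o cons0 _)) => v /=.
by rewrite cons0_word lext_word qsh_words.
Qed.

(** The bracket term merges two letters into one and is therefore shorter; the other two terms
    follow the recursion of [ins]. *)
Lemma qsh_head_lowers :
  lowers word (fun w => qsh_head w - insert_head word deg q w).
Proof.
case=> [|a w]; first by rewrite /= subrr; apply: span0.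
elim: w => [|b w IH]; first by rewrite /= subrr; apply: span0.
have -> : qsh_head [:: a, b & w] - insert_head word deg q [:: a, b & w] =
    q ^+ (deg a * deg b) *:
      cons0 (Some b) (qsh_head (a :: w) - ins word deg q a w)
    + cons0 (br (Some a) (Some b)) (word w).
  have -> : qsh_head [:: a, b & w] = word [:: a, b & w]
    + q ^+ (deg a * deg b) *: cons0 (Some b) (qsh_head (a :: w))
    + cons0 (br (Some a) (Some b)) (word w).
    rewrite /= cons0_word /wdeg big_seq1 big_nil mul0n expr0 scale1r.
    (* The product with the empty word on the left reduces only once [w] is a constructor. *)
    by case: (w).
  rewrite linearB scalerBr /= opprD [LHS](AC (3*2) ((1*4)*(2*5*3))) /=.
  by rewrite subrr add0r.
apply: spanD.
  apply/spanZ; apply: span_linear IH => v lt_v.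
  by rewrite cons0_word; apply: span_word.
case: (br _ _) => [c|]; last by rewrite cons0_None; apply: span0.
by rewrite cons0_word; apply: span_word.
Qed.

Context (deg_gt0 : forall a, (0 < deg a)%N).
Context (q_pow : forall n, (0 < n)%N -> q ^+ n != 1).

Lemma qsh_head_invertible n : invertible_upto word n qsh_head.
Proof.
have iB := insert_head_invertible word deg_gt0 q_pow.
apply: eq_invertible (invertible_perturb qsh_head_lowers iB n).
  move=> w; rewrite -[qsh_head w](subrK (insert_head word deg q w)).
  apply: spanD (filtered_insert_head word deg q w).
  exact: lowers_filtered qsh_head_lowers w.
by move=> w _; rewrite addrC subrK.
Qed.

(** Phi is L after Phi applied to the tail, and on tails the induction hypothesis applies. *)
Lemma Phiw_invertible n : invertible_upto word n Phiw.
Proof.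
have Phi_lmap w : Phiw w = lext qsh_head (lmap word (fun=> Phiw) w).
  by case: w => [|a w]; rewrite ?Phiw_cons //= lext_word.
have fPhi : filtered word Phiw.
  elim=> [|a w IH]; first exact: span_word.
  have [_ [fq _ _ _]] := qsh_head_invertible 0.
  by rewrite Phiw_cons; apply/lext_upto/cons0_upto.
elim: n => [|n IH].
  by apply: eq_invertible (invertible_id word 0) => // -[].
have iP := invertible_lmap (fun=> IH).
by apply: eq_invertible (invertible_comp (qsh_head_invertible _) iP).
Qed.

Lemma Phiw_bij : bijective (lext Phiw).
Proof. exact: invertible_bij Phiw_invertible. Qed.

End QuasiShuffle.

(** * Transfer to the concrete product on k<A> *)

Section NcpolyQuasiShuffle.
Context (k : fieldType) (A : choiceType) (deg : A -> nat).
Context (br : option A -> option A -> option A) (q : k).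
Local Notation e := (ncpoly_basis k A).
Implicit Types (f g : ncpoly k A) (u v w : seq A).

Lemma letter0_mulE x f : letter0 k x * f = cons0 e x f.
Proof.
case: x => [a|]; first exact: letter_mulE.
exact: etrans (mul0r f) (esym (cons0_None e f)).
Qed.

Lemma qsh_word_cons a u b v :
  qsh_word deg br q (a :: u) (b :: v) =
    cons0 e (Some a) (qsh_word deg br q u (b :: v))
    + q ^+ (wdeg deg (a :: u) * deg b) *:
        cons0 e (Some b) (qsh_word deg br q (a :: u) v)
    + q ^+ (wdeg deg u * deg b) *:
        cons0 e (br (Some a) (Some b)) (qsh_word deg br q u v).
Proof. by rewrite -!letter0_mulE; exact: erefl. Qed.

Lemma qsh_wordE u v : qsh_word deg br q u v = qshw e deg br q u v.
Proof.
elim: u v => [|a u IHu] v; first by case: v => [|b v]; exact: erefl.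
elim: v => [|b v IHv]; first exact: erefl.
rewrite qsh_word_cons !IHu IHv; exact: erefl.
Qed.

Lemma qshE f g : qsh deg br q f g = qshe e deg br q f g.
Proof.
rewrite /qsh /qshe /= /ncpoly_ext; apply: eq_bigr => u _.
rewrite scaler_sumr; apply: eq_bigr => v _.
by rewrite scalerA qsh_wordE.
Qed.

Lemma Phi_wordE w : Phi_word deg br q w = Phiw e deg br q w.
Proof.
rewrite /Phi_word /Phiw -[bvec e [::]]/(word k [::]) word_nil.
elim: w 1 => //= a w IH f; by rewrite qshE IH.
Qed.

Lemma PhiE f : Phi deg br q f = lext e (Phiw e deg br q) f.
Proof. by apply: eq_bigr => w _; rewrite Phi_wordE. Qed.

End NcpolyQuasiShuffle.

Theorem theorem5p4 (R : realType) (K : {pred R[i]}) (k : subFieldType K)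
    (A : choiceType) (deg : A -> nat)
    (deg_ge1 : forall a : A, (1 <= deg a)%N)
    (deg_fin : forall n : nat, finite_set [set a : A | deg a = n]%classic)
    (br : option A -> option A -> option A)
    (S0 : forall a : option A, br a None = None)
    (S1 : forall a b : option A, br a b = br b a)
    (S2 : forall a b c : option A, br (br a b) c = br a (br b c))
    (S3 : forall a b : A, br (Some a) (Some b) = None \/
            exists2 c : A, br (Some a) (Some b) = Some c &
                           deg c = (deg a + deg b)%N)
    (q : k)
    (q_not_root : ~ exists2 n : nat, (0 < n)%N & n.-unity_root q) :
  generic deg br q.
Proof.
have q_pow n : (0 < n)%N -> q ^+ n != 1.
  move=> n_gt0; apply/eqP => qn1; apply: q_not_root; exists n => //.
  by rewrite unity_rootE qn1 eqxx.
split.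
- by move=> c f g; rewrite !PhiE linearP.
- by rewrite PhiE -word_nil [LHS]ncpoly_ext_word.
- by move=> f g; rewrite qshE !PhiE mul_ncpolyE; apply: Phiw_mul.
- apply: eq_bij (Phiw_bij (ncpoly_basis k A) S0 S1 S2 S3 deg_ge1 q_pow) _ _.
  by move=> f; rewrite PhiE.
Qed.
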